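(* Let $M_1,M_2\in\mathbb{C}^{n\times n}$ be two commuting matrices, each with pairwise distinct eigenvalues. Let $E_0,F_0\in\mathbb{C}^{n\times n}$ be invertible and, for $k=1,2$, let $\Sigma_{0,k}=\mathrm{diag}(\sigma_{0,1}^k,\dots,\sigma_{0,n}^k)$ be a diagonal matrix with pairwise distinct diagonal entries; assume $\sigma_{0,j}^1\sigma_{0,l}^2-\sigma_{0,l}^1\sigma_{0,j}^2\neq0$ for all $j\ne l$. Define sequences, for $i\ge0$ and $k=1,2$, by $$Z_{i,k}=F_iM_kE_i-\Sigma_{i,k},\quad S_{i,k}=\mathrm{diag}(Z_{i,k}),$$ $$E_{i+1}=E_i(I_n+X_i),\quad F_{i+1}=(I_n+Y_i)F_i,\quad \Sigma_{i+1,k}=\Sigma_{i,k}+S_{i,k},$$ where, writing $\Sigma_{i,k}=\mathrm{diag}(\sigma_{i,1}^k,\dots,\sigma_{i,n}^k)$ and $z^k_{j,l}=(Z_{i,k})_{j,l}$, the matrices $X_i,Y_i$ have zero diagonal and, for $j\neq l$, $$(X_i)_{j,l}=\frac{\sigma_{i,l}^1z_{j,l}^2-\sigma_{i,l}^2z_{j,l}^1}{\sigma_{i,j}^1\sigma_{i,l}^2-\sigma_{i,l}^1\sigma_{i,j}^2},\qquad (Y_i)_{j,l}=-\frac{\sigma_{i,j}^1z_{j,l}^2-\sigma_{i,j}^2z_{j,l}^1}{\sigma_{i,j}^1\sigma_{i,l}^2-\sigma_{i,l}^1\sigma_{i,j}^2}.$$ Let $\varepsilon_0=\max(\|Z_{0,1}\|,\|Z_{0,2}\|)$,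 $$\kappa_0=\max\Bigl(1,\max_{j\ne l}\frac{1}{|\sigma_{0,j}^1\sigma_{0,l}^2-\sigma_{0,l}^1\sigma_{0,j}^2|}\Bigr),\qquad K_0=\max\bigl(1,\max_{j,k}|\sigma_{0,j}^k|\bigr),$$ and assume that $$u:=4\varepsilon_0\kappa_0^2K_0^3\le 0.094.$$ Then the sequences $(\Sigma_{i,k},E_i,F_i)_{i\ge0}$, $k=1,2$, converge quadratically to a solution $(\Sigma_{\infty,k},E_\infty,F_\infty)$ of $FM_kE-\Sigma_k=0$, $k=1,2$. More precisely, $E_0$ and $F_0$ are invertible and, for all $i\ge0$, $$\|E_i-E_\infty\|\le1.46\times2^{1-2^{i+1}}\|E_0\|u,\qquad \|F_i-F_\infty\|\le1.46\times2^{1-2^{i+1}}\|F_0\|u.$$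
   Context: For a matrix $A\in\mathbb{C}^{n\times n}$, $\|A\|=\max_{1\le i\le n}\sum_{j=1}^n|a_{i,j}|$ is the operator norm induced by the sup norm on $\mathbb{C}^n$. For a matrix $A$, $\mathrm{diag}(A)$ is the diagonal matrix with the same diagonal as $A$; for scalars, $\mathrm{diag}(\lambda_1,\dots,\lambda_n)$ is the diagonal matrix with these entries. The unknowns of the system $FM_kE-\Sigma_k=0$, $k=1,2$, are $E,F\in\mathbb{C}^{n\times n}$ and diagonal matrices $\Sigma_1,\Sigma_2$. The quadratic convergence is made precise by the displayed bounds. *)

(* Defs.v *)
(* MathComp / MathComp-Analysis; complex numbers are R[i] over R : realType. *)
From mathcomp Require Import all_boot all_order all_algebra.
From mathcomp Require Import all_classical all_reals.
From mathcomp Require Export complex.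

Set Implicit Arguments.
Unset Strict Implicit.
Unset Printing Implicit Defensive.

Import Order.TTheory GRing.Theory Num.Theory.
Local Open Scope ring_scope.
Local Open Scope complex_scope.

(* The R-valued modulus; the generic norm `|z| takes its values in R[i]. *)
Notation cmod := ComplexField.Normc.normc.

Section Defs.
Variables (R : realType) (n : nat).
Implicit Types A M S Z : 'M[R[i]]_n.

Definition opnorm A : R := \big[Num.max/0]_(i < n) \sum_(j < n) cmod (A i j).

Definition diag_part A : 'M[R[i]]_n := diag_mx (\row_j A j j).

(* In dimension n, having n different eigenvalues means that all the
   eigenvalues are simple. *)
Definition distinct_eigenvalues M : Prop :=
  exists s : n.-tuple R[i], uniq s /\ {in s, forall a, eigenvalue M a}.

Definition sdet S1 S2 (j l : 'I_n) : R[i] :=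
  S1 j j * S2 l l - S1 l l * S2 j j.

(* Both maxima include 1, which is also their value over an empty range
   (kappa when n <= 1). *)
Definition kappa S1 S2 : R :=
  \big[Num.max/1]_(p : 'I_n * 'I_n | p.1 != p.2) (cmod (sdet S1 S2 p.1 p.2))^-1.

Definition Kmax S1 S2 : R :=
  \big[Num.max/1]_(j < n) Num.max (cmod (S1 j j)) (cmod (S2 j j)).

(* The off-diagonal entries solve, for k = 1, 2, the linearized equation
   (Zk + Y *m Sk + Sk *m X) j l = 0. *)
Definition Xcorr S1 S2 Z1 Z2 : 'M[R[i]]_n :=
  \matrix_(j, l) if j == l then 0 else
    (S1 l l * Z2 j l - S2 l l * Z1 j l) / sdet S1 S2 j l.

Definition Ycorr S1 S2 Z1 Z2 : 'M[R[i]]_n :=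
  \matrix_(j, l) if j == l then 0 else
    - ((S1 j j * Z2 j l - S2 j j * Z1 j l) / sdet S1 S2 j l).

End Defs.

Definition quad_rate (R : realType) (i : nat) : R :=
  2 ^ (1 - (2 ^ i.+1)%N%:Z).

(* Errors bounded by a constant times 2 ^ (1 - 2 ^ (i + 1)). *)
Definition cvg_quadratically (R : realType) (n : nat)
    (A : nat -> 'M[R[i]]_n) (L : 'M[R[i]]_n) : Prop :=
  exists c : R, forall i, opnorm (A i - L) <= c * quad_rate R i.

(* Main.v *)
(* With r_i = 2 ^ (1 - 2 ^ (i + 1)), so that r_(i+1) = r_i ^ 2 / 2, one Newton
   step cancels the first-order part of the residual. The scale-free quantity
   v_i = 4 e_i k_i ^ 2 K_i ^ 3, where e_i, 1 / k_i and K_i bound the residuals,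
   the 2 x 2 determinants and the diagonal entries at step i, then satisfies
   v_(i+1) <= 2.655 v_i ^ 2. Since 2.655 * 4 * 0.094 < 1, this gives
   v_i <= 2 r_i u, hence corrections of norm at most r_i u. Working with
   E_0 ^ -1 E_i and F_i F_0 ^ -1, which start at the identity, the products
   converge, and their limits stay at distance less than 1 from the identity,
   so they are invertible. *)

Require Import Defs.
From mathcomp Require Import all_boot all_order all_algebra.
From mathcomp Require Import all_classical all_reals.
From mathcomp Require Import zify ring lra.

Set Implicit Arguments.
Unset Strict Implicit.
Unset Printing Implicit Defensive.

Import Order.TTheory GRing.Theory Num.Theory.
Local Open Scope ring_scope.
Local Open Scope complex_scope.

(** * The real-valued modulus on complex numbers *)

Section Modulus.
Variable R : realType.
Implicit Types x y : R[i].

Lemma cmod_ge0 x : 0 <= cmod x.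
Proof. by case: x => a b; exact: sqrtr_ge0. Qed.

Lemma cmodD x y : cmod (x + y) <= cmod x + cmod y.
Proof. exact: le_normcD. Qed.

Lemma cmodN x : cmod (- x) = cmod x.
Proof. exact: normcN. Qed.

Lemma cmodM x y : cmod (x * y) = cmod x * cmod y.
Proof. exact: ComplexField.Normc.normcM. Qed.

Lemma cmod_sum (I : finType) (f : I -> R[i]) :
  cmod (\sum_i f i) <= \sum_i cmod (f i).
Proof.
elim/big_ind2: _ => [|x a y b xa yb|//].
  by rewrite ComplexField.Normc.normc0.
exact: le_trans (cmodD _ _) (lerD xa yb).
Qed.

Lemma Re_le_cmod x : `|complex.Re x| <= cmod x.
Proof.
by case: x => a b /=; rewrite -sqrtr_sqr ler_wsqrtr// lerDl sqr_ge0.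
Qed.

Lemma Im_le_cmod x : `|complex.Im x| <= cmod x.
Proof.
by case: x => a b /=; rewrite -sqrtr_sqr ler_wsqrtr// lerDr sqr_ge0.
Qed.

Lemma cmod_le_ReIm x : cmod x <= `|complex.Re x| + `|complex.Im x|.
Proof.
case: x => a b /=; rewrite -[leRHS]ger0_norm ?addr_ge0// -sqrtr_sqr.
rewrite ler_wsqrtr// sqrrD !real_normK ?num_real// addrAC lerDl.
by rewrite mulrn_wge0// mulr_ge0.
Qed.

End Modulus.

(** * The operator norm given by maximal row sums, and invertibility near the identity *)

Section OperatorNorm.
Variables (R : realType) (n : nat).
Implicit Types A B : 'M[R[i]]_n.

Lemma row_le_opnorm A i : \sum_(j < n) cmod (A i j) <= opnorm A.
Proof.
by rewrite /opnorm; apply: (le_bigmax _ (fun i => \sum_(j < n) cmod (A i j))).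
Qed.

Lemma opnorm_le A c :
  0 <= c -> (forall i, \sum_(j < n) cmod (A i j) <= c) -> opnorm A <= c.
Proof. by move=> c0 Ac; apply: bigmax_le => // i _. Qed.

Lemma opnorm_ge0 A : 0 <= opnorm A.
Proof. exact: bigmax_ge_id. Qed.

Lemma entry_le_opnorm A i j : cmod (A i j) <= opnorm A.
Proof.
apply: le_trans (row_le_opnorm A i); rewrite (bigD1 j)//= lerDl.
by apply: sumr_ge0 => k _; exact: cmod_ge0.
Qed.

Lemma opnormD A B : opnorm (A + B) <= opnorm A + opnorm B.
Proof.
apply: opnorm_le => [|i]; first by rewrite addr_ge0 ?opnorm_ge0.
apply: le_trans (lerD (row_le_opnorm A i) (row_le_opnorm B i)).
by rewrite -big_split; apply: ler_sum => j _; rewrite !mxE; exact: cmodD.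
Qed.

Lemma opnormN A : opnorm (- A) = opnorm A.
Proof.
by apply: eq_bigr => i _; apply: eq_bigr => j _; rewrite !mxE cmodN.
Qed.

Lemma opnormB A B : opnorm (A - B) <= opnorm A + opnorm B.
Proof. by rewrite -(opnormN B); exact: opnormD. Qed.

Lemma opnormM A B : opnorm (A *m B) <= opnorm A * opnorm B.
Proof.
apply: opnorm_le => [|i]; first by rewrite mulr_ge0 ?opnorm_ge0.
apply: le_trans (ler_wpM2r (opnorm_ge0 B) (row_le_opnorm A i)).
rewrite mulr_suml.
have le1 : \sum_j cmod ((A *m B) i j)
    <= \sum_j \sum_k cmod (A i k) * cmod (B k j).
  apply: ler_sum => j _; rewrite !mxE.
  apply: le_trans (cmod_sum _) _; apply: ler_sum => k _.
  by rewrite cmodM.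
apply: le_trans le1 _; rewrite exchange_big; apply: ler_sum => k _.
by rewrite -mulr_sumr ler_wpM2l ?cmod_ge0// row_le_opnorm.
Qed.

Lemma opnormM_le A B a b :
  opnorm A <= a -> opnorm B <= b -> opnorm (A *m B) <= a * b.
Proof.
move=> Aa Bb; apply: le_trans (opnormM _ _) _.
by apply: ler_pM; rewrite ?opnorm_ge0.
Qed.

Lemma opnorm0 : opnorm (0 : 'M[R[i]]_n) = 0.
Proof.
apply/eqP; rewrite eq_le opnorm_ge0 andbT opnorm_le// => i.
by rewrite big1// => j _; rewrite mxE ComplexField.Normc.normc0.
Qed.

Lemma opnorm1 : opnorm (1%:M : 'M[R[i]]_n) <= 1.
Proof.
apply: opnorm_le => // i; rewrite (bigD1 i)//= mxE eqxx ComplexField.Normc.normc1.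
rewrite big1 ?addr0// => j ji.
by rewrite mxE eq_sym (negPf ji) ComplexField.Normc.normc0.
Qed.

Lemma opnorm_diag_part A : opnorm (diag_part A) <= opnorm A.
Proof.
apply: opnorm_le => [|i]; first exact: opnorm_ge0.
apply: le_trans (row_le_opnorm A i); apply: ler_sum => j _.
rewrite !mxE; case: eqVneq => [->|_]; rewrite ?mulr1n ?mulr0n//.
by rewrite ComplexField.Normc.normc0 cmod_ge0.
Qed.

(** The factor [n] is crude but harmless: the bound only serves to make an error term tend to
    zero. *)
Lemma opnorm_le_entries A c :
  (forall i j, cmod (A i j) <= c) -> 0 <= c -> opnorm A <= c *+ n.
Proof.
move=> Ac c0; apply: opnorm_le => [|i]; first by rewrite mulrn_wge0.
apply: le_trans (_ : \sum_(j < n) c <= _); first by apply: ler_sum.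
by rewrite sumr_const card_ord.
Qed.

(* At a coordinate of maximal modulus, a vector killed by [1 + A] is bounded
   by [opnorm A] times itself. *)
Lemma unitmx_opnorm_lt1 A : opnorm A < 1 -> 1%:M + A \in unitmx.
Proof.
(* [det0P] yields a row vector in a left kernel, while [opnorm] measures row sums; transposing first
   reconciles the two. *)
move=> A1; rewrite -unitmx_tr unitmxE unitfE; apply/det0P => -[v v0 vA].
have /rV0Pn[j0 vj0] := v0.
pose j := [arg max_(j > j0) cmod (v 0 j)]%O.
have vj k : cmod (v 0 k) <= cmod (v 0 j).
  by rewrite /j; case: arg_maxP => //= m _; apply.
have v_gt0 : 0 < cmod (v 0 j).
  apply: lt_le_trans (vj j0); rewrite lt_def cmod_ge0 andbT.
  by apply: contra vj0 => /eqP/ComplexField.Normc.eq0_normc ->.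
have /matrixP/(_ 0 j) := vA.
rewrite linearD/= trmx1 mulmxDr mulmx1 !mxE => /eqP.
rewrite addr_eq0 => /eqP vE.
have : cmod (v 0 j) <= opnorm A * cmod (v 0 j).
  rewrite {1}vE cmodN.
  apply: le_trans (cmod_sum _) _.
  apply: le_trans (ler_wpM2r (cmod_ge0 _) (row_le_opnorm A j)).
  rewrite mulr_suml; apply: ler_sum => k _.
  by rewrite mxE cmodM mulrC ler_wpM2l ?cmod_ge0.
by move: A1 v_gt0; nra.
Qed.

End OperatorNorm.

(** * The rate 2 ^ (1 - 2 ^ (i + 1)) and its convergence to zero *)

Section QuadRate.
Variable R : realType.
Local Notation r := (quad_rate R).

Lemma quad_rate0 : r 0 = 2^-1.
Proof. by rewrite /quad_rate. Qed.

Lemma quad_rate_gt0 i : 0 < r i.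
Proof. by rewrite /quad_rate exprz_gt0. Qed.

Lemma quad_rateS i : r i.+1 = r i ^+ 2 / 2.
Proof.
rewrite /quad_rate expnS mul2n -addnn PoszD.
set m : int := Posz _.
have -> : 1 - (m + m) = (1 - m) + (1 - m) - 1 by ring.
by rewrite !expfzDr ?pnatr_eq0// -expr2.
Qed.

Lemma quad_rate_le i : r i <= 2^-1.
Proof.
elim: i => [|i IH]; first by rewrite quad_rate0.
rewrite quad_rateS; have := quad_rate_gt0 i; nra.
Qed.

(** One factor of [r i ^+ 2] is at most 1/2. The ratio 1/4 is the origin of the constant 4/3 in the
    bounds on tails. *)
Lemma quad_rateS_le i : r i.+1 <= r i / 4.
Proof.
rewrite quad_rateS; have := quad_rate_gt0 i; have := quad_rate_le i; nra.
Qed.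

(** Far from sharp, but enough, with the Archimedean property, to see the rate tend to zero. *)
Lemma quad_rate_le_harmonic i : r i <= i.+1%:R^-1.
Proof.
elim: i => [|i IH]; first by have := quad_rate_le 0; lra.
apply: le_trans (quad_rateS_le i) _.
apply: le_trans (_ : i.+1%:R^-1 / 4 <= _).
  by rewrite ler_wpM2r// invr_ge0 ler0n.
rewrite -invfM lef_pV2 ?posrE ?mulr_gt0// -natrM ler_nat; lia.
Qed.

(** Lets [i] tend to infinity in an inequality, without any topology. *)
Lemma le_of_quad_rate (x a c : R) : (forall i, x <= a + c * r i) -> x <= a.
Proof.
move=> xa; case: (leP c 0) => [c0|c0].
  by apply: le_trans (xa 0%N) _; have := quad_rate_gt0 0; nra.
rewrite leNgt; apply/negP => ax.
(* Here [i.+1] exceeds [c / (x - a)], so the harmonic bound brings [c * r i] below [x - a], a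
   contradiction. *)
pose i := Num.truncn (c / (x - a)).
have := truncnS_gt (c / (x - a)); rewrite -/i ltr_pdivrMr ?subr_gt0// => ci.
have ri := ler_wpM2l (ltW c0) (quad_rate_le_harmonic i).
have := le_trans (xa i) (lerD (lexx a) ri).
by rewrite -lerBlDl ler_pdivlMr// mulrC leNgt ci.
Qed.

End QuadRate.

(** * Limits of sequences with controlled increments *)

Section Limits.
Variable R : realType.

Lemma nonincreasing_telescope (d : nat -> R) i j :
  (forall i, d i.+1 <= d i) -> (i <= j)%N -> d j <= d i.
Proof.
move=> dS; elim: j => [|j IH]; first by rewrite leqn0 => /eqP ->.
by rewrite leq_eqVlt => /predU1P[->//|/IH]; exact: le_trans.
Qed.

(* [x - d] increases, [x + d] decreases, and both have the same limit. *)
Lemma real_limit (x d : nat -> R) :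
  (forall i, 0 <= d i) -> (forall i, `|x i.+1 - x i| <= d i - d i.+1) ->
  exists l, forall i, `|x i - l| <= d i.
Proof.
move=> d0 xd.
have lo i j : (i <= j)%N -> x i - d i <= x j - d j.
  move=> ij; rewrite -lerN2.
  apply: (@nonincreasing_telescope (fun i => - (x i - d i))) => // k.
  by have := xd k; rewrite ler_norml; lra.
have hi i j : (i <= j)%N -> x j + d j <= x i + d i.
  apply: (@nonincreasing_telescope (fun i => x i + d i)) => // k.
  by have := xd k; rewrite ler_norml; lra.
have lohi i j : x i - d i <= x j + d j.
  have := lo _ _ (leq_maxl i j); have := hi _ _ (leq_maxr i j).
  have := d0 (maxn i j); lra.
pose A := range (fun i => x i - d i).
have ubA j : ubound A (x j + d j) by move=> _ [i _ <-].
have A0 : (A !=set0)%classic by exists (x 0%N - d 0%N), 0%N.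
exists (sup A) => i.
have : x i - d i <= sup A.
  by apply: ub_le_sup; [exists (x 0%N + d 0%N); exact: ubA | exists i].
have : sup A <= x i + d i by apply: ge_sup => //; exact: ubA.
by rewrite ler_norml; lra.
Qed.

(** The factor 2 comes from treating real and imaginary parts separately; [matrix_limit] gets rid of
    it afterwards. *)
Lemma complex_limit (x : nat -> R[i]) (d : nat -> R) :
  (forall i, 0 <= d i) -> (forall i, cmod (x i.+1 - x i) <= d i - d i.+1) ->
  exists l, forall i, cmod (x i - l) <= 2 * d i.
Proof.
move=> d0 xd.
have [i|a xa] := @real_limit (fun i => complex.Re (x i)) d d0.
  by rewrite -raddfB/=; exact: le_trans (Re_le_cmod _) (xd i).
have [i|b xb] := @real_limit (fun i => complex.Im (x i)) d d0.
  by rewrite -raddfB/=; exact: le_trans (Im_le_cmod _) (xd i).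
exists (a +i* b) => i; apply: le_trans (cmod_le_ReIm _) _.
have := xa i; have := xb i; case: (x i) => c e /=; lra.
Qed.

Variable n : nat.

(** The bounds on the increments decay at least geometrically with ratio 1/4, so a tail is at most
    4/3 of its first term. The limit is built entrywise with a crude error, then compared with a far
    iterate to obtain a constant independent of [n]. *)
Lemma matrix_limit (A : nat -> 'M[R[i]]_n) (c : R) :
  (forall i, opnorm (A i.+1 - A i) <= c * quad_rate R i) ->
  exists L, forall i, opnorm (A i - L) <= 4 / 3 * c * quad_rate R i.
Proof.
move=> Ac.
have c0 : 0 <= c.
  have := le_trans (opnorm_ge0 _) (Ac 0%N).
  by rewrite pmulr_lge0// quad_rate_gt0.
pose d i := 4 / 3 * c * quad_rate R i.
have d0 i : 0 <= d i.
  by rewrite !mulr_ge0 ?invr_ge0// ltW ?quad_rate_gt0.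
have Ad i : opnorm (A i.+1 - A i) <= d i - d i.+1.
  apply: le_trans (Ac i) _; rewrite /d.
  have := quad_rateS_le R i; nra.
have dist i j : opnorm (A i - A (i + j)%N) <= d i - d (i + j)%N.
  elim: j => [|j IH].
    by rewrite addn0 !subrr opnorm0.
  rewrite addnS; have := Ad (i + j)%N; rewrite -opnormN opprB => H.
  have := le_trans (opnormD _ _) (lerD IH H); rewrite addrA subrK; lra.
have lim k l : exists z, forall i, cmod (A i k l - z) <= 2 * d i.
  apply: complex_limit => // i; apply: le_trans (Ad i).
  by have := entry_le_opnorm (A i.+1 - A i) k l; rewrite !mxE.
pose L := \matrix_(k, l) sval (cid (lim k l)).
have AL k l i : cmod (A i k l - L k l) <= 2 * d i.
  by rewrite mxE; exact: (svalP (cid (lim k l))).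
exists L => i.
(* As [j] grows, the dimension-dependent error of iterate [i + j] disappears; only the telescoped
   distance, at most [d i], remains. *)
apply: (@le_of_quad_rate _ _ _ (2 * (4 / 3 * c) *+ n)) => j.
have ALn : opnorm (A (i + j)%N - L) <= (2 * d (i + j)%N) *+ n.
  apply: opnorm_le_entries => [k l|]; last by rewrite mulr_ge0.
  by have := AL k l (i + j)%N; rewrite !mxE.
have dj : (2 * d (i + j)%N) *+ n <= (2 * d j) *+ n.
  rewrite lerMn2r ler_pM2l// nonincreasing_telescope ?orbT ?leq_addl// => k.
  by have := le_trans (opnorm_ge0 _) (Ad k); rewrite subr_ge0.
have := le_trans (opnormD _ _) (lerD (dist i j) (le_trans ALn dj)).
rewrite addrA subrK => /le_trans; apply.
have -> : 2 * (4 / 3 * c) *+ n * quad_rate R j = 2 * d j *+ n.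
  by rewrite mulrnAl /d !mulrA.
by have := d0 (i + j)%N; rewrite -/(d i); move: (_ *+ n) => *; lra.
Qed.

End Limits.

(** * One Newton step: linearized equations and size of the corrections *)

Section NewtonStep.
Variables (R : realType) (n : nat).
Implicit Types S Z X Y : 'M[R[i]]_n.

Lemma is_diag_mx_offdiag S j l : is_diag_mx S -> j != l -> S j l = 0.
Proof. by move=> /is_diag_mxP; apply. Qed.

Lemma mulmx_diag_entry S X j l : is_diag_mx S -> (X *m S) j l = X j l * S l l.
Proof.
move=> Sd; rewrite mxE (bigD1 l)//= big1 ?addr0// => k kl.
by rewrite (is_diag_mx_offdiag Sd kl) mulr0.
Qed.

Lemma diag_mulmx_entry S X j l : is_diag_mx S -> (S *m X) j l = S j j * X j l.
Proof.
move=> Sd; rewrite mxE (bigD1 j)//= big1 ?addr0// => k; rewrite eq_sym => kj.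
by rewrite (is_diag_mx_offdiag Sd kj) mul0r.
Qed.

(** Cramer's rule: off the diagonal, the entries of [Ycorr] and [Xcorr] at a given position solve
    two linear equations, one for each of the two residuals, with determinant [sdet] up to sign. On
    the diagonal both sides vanish. This is the first equation; the next lemma is the second. *)
Lemma corr_linearized1 S1 S2 Z1 Z2 :
  is_diag_mx S1 -> (forall j l, j != l -> sdet S1 S2 j l != 0) ->
  Ycorr S1 S2 Z1 Z2 *m S1 + S1 *m Xcorr S1 S2 Z1 Z2 = diag_part Z1 - Z1.
Proof.
move=> Sd sd; apply/matrixP => j l.
rewrite [LHS]mxE mulmx_diag_entry// diag_mulmx_entry// !mxE.
case: eqVneq => [->|jl]; first by rewrite mulr1n subrr mul0r mulr0 addr0.
have := sd _ _ jl; rewrite mulr0n /sdet => sd'; field.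
exact: sd'.
Qed.

Lemma corr_linearized2 S1 S2 Z1 Z2 :
  is_diag_mx S2 -> (forall j l, j != l -> sdet S1 S2 j l != 0) ->
  Ycorr S1 S2 Z1 Z2 *m S2 + S2 *m Xcorr S1 S2 Z1 Z2 = diag_part Z2 - Z2.
Proof.
move=> Sd sd; apply/matrixP => j l.
rewrite [LHS]mxE mulmx_diag_entry// diag_mulmx_entry// !mxE.
case: eqVneq => [->|jl]; first by rewrite mulr1n subrr mul0r mulr0 addr0.
have := sd _ _ jl; rewrite mulr0n /sdet => sd'; field.
exact: sd'.
Qed.

(* The first-order part [Z - diag Z + Y S + S X] of the new residual vanishes;
   what is left is quadratic. *)
Lemma residual_bound S Z X Y e x K :
  Y *m S + S *m X = diag_part Z - Z ->
  opnorm X <= x -> opnorm Y <= x -> opnorm Z <= e -> opnorm S <= K ->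
  opnorm ((1%:M + Y) *m (Z + S) *m (1%:M + X) - (S + diag_part Z))
    <= 2 * x * e + x ^+ 2 * K + x ^+ 2 * e.
Proof.
move=> lin Xx Yx Ze SK.
have -> : (1%:M + Y) *m (Z + S) *m (1%:M + X) - (S + diag_part Z)
   = (Y *m S + S *m X - (diag_part Z - Z))
     + (Y *m Z + Z *m X + (Y *m S *m X + Y *m Z *m X)).
  rewrite !mulmxDl !mulmxDr !mulmxDl !mul1mx !mulmx1.
  move: (Y *m Z *m X) (Y *m S *m X) (Y *m Z) (Y *m S) (Z *m X) (S *m X).
  move: (diag_part Z) => *; apply/matrixP => j l; rewrite !mxE; ring.
rewrite lin subrr add0r.
have YZ := opnormM_le Yx Ze; have ZX := opnormM_le Ze Xx.
have YSX := opnormM_le (opnormM_le Yx SK) Xx.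
have YZX := opnormM_le YZ Xx.
apply: le_trans (opnormD _ _) _.
have h1 := le_trans (opnormD _ _) (lerD YZ ZX).
have h2 := le_trans (opnormD _ _) (lerD YSX YZX).
by apply: le_trans (lerD h1 h2) _; lra.
Qed.

Section CorrBound.
Variables (S1 S2 Z1 Z2 : 'M[R[i]]_n) (e k K : R).
Hypotheses (k_ge0 : 0 <= k) (K_ge0 : 0 <= K).
Hypothesis sdet_k : forall j l, j != l -> 1 <= k * cmod (sdet S1 S2 j l).
Hypotheses (S1_K : forall j, cmod (S1 j j) <= K)
           (S2_K : forall j, cmod (S2 j j) <= K).
Hypotheses (Z1_e : opnorm Z1 <= e) (Z2_e : opnorm Z2 <= e).

(** Used with [m = l] for [Xcorr] and, up to sign, with [m = j] for [Ycorr]. *)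
Let frac_bound j l m : j != l ->
  cmod ((S1 m m * Z2 j l - S2 m m * Z1 j l) / sdet S1 S2 j l)
    <= k * K * (cmod (Z1 j l) + cmod (Z2 j l)).
Proof.
move=> jl; rewrite cmodM ComplexField.Normc.normcV mulrC -mulrA.
have sd_gt0 : 0 < cmod (sdet S1 S2 j l).
  rewrite lt_def cmod_ge0 andbT; apply/eqP => c0.
  by have := sdet_k jl; rewrite c0 mulr0 ler10.
have sd_k : (cmod (sdet S1 S2 j l))^-1 <= k.
  by rewrite -[leLHS]mul1r ler_pdivrMr// sdet_k.
apply: ler_pM; rewrite ?invr_ge0 ?cmod_ge0//.
apply: le_trans (cmodD _ _) _; rewrite cmodN !cmodM addrC mulrDr.
by apply: lerD; rewrite ler_wpM2r ?cmod_ge0.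
Qed.

(** A row sum of [Z1] and one of [Z2] contribute at most [e] each, hence the factor 2. *)
Let opnorm_entrywise (X : 'M[R[i]]_n) :
  (forall j l, cmod (X j l) <= k * K * (cmod (Z1 j l) + cmod (Z2 j l))) ->
  opnorm X <= 2 * k * K * e.
Proof.
move=> Xkl; have e0 : 0 <= e := le_trans (opnorm_ge0 _) Z1_e.
apply: opnorm_le => [|j]; first by rewrite !mulr_ge0.
apply: le_trans (ler_sum _ (fun l _ => Xkl j l)) _.
rewrite -mulr_sumr big_split/=.
have := le_trans (row_le_opnorm Z1 j) Z1_e.
have := le_trans (row_le_opnorm Z2 j) Z2_e.
have := mulr_ge0 k_ge0 K_ge0; nra.
Qed.

Lemma Xcorr_bound : opnorm (Xcorr S1 S2 Z1 Z2) <= 2 * k * K * e.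
Proof.
apply: opnorm_entrywise => j l; rewrite mxE; case: eqVneq => [_|jl].
  by rewrite ComplexField.Normc.normc0 !mulr_ge0// addr_ge0// cmod_ge0.
exact: frac_bound.
Qed.

Lemma Ycorr_bound : opnorm (Ycorr S1 S2 Z1 Z2) <= 2 * k * K * e.
Proof.
apply: opnorm_entrywise => j l; rewrite mxE; case: eqVneq => [_|jl].
  by rewrite ComplexField.Normc.normc0 !mulr_ge0// addr_ge0// cmod_ge0.
by rewrite cmodN; exact: frac_bound.
Qed.

End CorrBound.

End NewtonStep.

(** * Contraction along the iteration and passage to the limit *)

Section Iteration.
Variables (R : realType) (n : nat).
Implicit Types S T Z M E F : 'M[R[i]]_n.
Local Notation r := (quad_rate R).

(* [e], [k], [K] are only required to be bounds, not the exact maxima; [v] is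
   the quantity that contracts quadratically. *)
Record newton_bounds S1 S2 Z1 Z2 (v e k K : R) : Prop := NewtonBounds {
  nb_diag1 : is_diag_mx S1;
  nb_diag2 : is_diag_mx S2;
  nb_k : 1 <= k;
  nb_K : 1 <= K;
  nb_v : 4 * e * k ^+ 2 * K ^+ 3 <= v;
  nb_sdet : forall j l, j != l -> 1 <= k * cmod (sdet S1 S2 j l);
  nb_S1 : forall j, cmod (S1 j j) <= K;
  nb_S2 : forall j, cmod (S2 j j) <= K;
  nb_Z1 : opnorm Z1 <= e;
  nb_Z2 : opnorm Z2 <= e }.

Lemma nb_e_ge0 S1 S2 Z1 Z2 v e k K :
  newton_bounds S1 S2 Z1 Z2 v e k K -> 0 <= e.
Proof. by case=> *; exact: le_trans (opnorm_ge0 Z1) _. Qed.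

Lemma opnorm_diag_le S K :
  is_diag_mx S -> 0 <= K -> (forall j, cmod (S j j) <= K) -> opnorm S <= K.
Proof.
move=> Sd K0 SK; apply: opnorm_le => // j.
rewrite (bigD1 j)//= big1 ?addr0// => l; rewrite eq_sym => jl.
by rewrite (is_diag_mx_offdiag Sd jl) ComplexField.Normc.normc0.
Qed.

Lemma nb_sdet_neq0 S1 S2 Z1 Z2 v e k K j l :
  newton_bounds S1 S2 Z1 Z2 v e k K -> j != l -> sdet S1 S2 j l != 0.
Proof.
move=> nb jl; apply/eqP => s0; have := nb_sdet nb jl.
by rewrite s0 ComplexField.Normc.normc0 mulr0 ler10.
Qed.

(** The weight [k ^+ 2 * K ^+ 3] dominates both 1 and [k * K]. The second bound controls the
    corrections, of norm at most [2 * k * K * e]. *)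
Lemma small_of_weighted (v e k K : R) :
  0 <= e -> 1 <= k -> 1 <= K -> 4 * e * k ^+ 2 * K ^+ 3 <= v ->
  [/\ 4 * e <= v & 4 * (k * K * e) <= v].
Proof.
move=> e0 k1 K1 ev.
have kK : 1 <= k * K by nra.
have PkK : k * K <= k ^+ 2 * K ^+ 3.
  have : k ^+ 2 * K ^+ 3 = (k * K) * ((k * K) * K) by ring.
  move=> ->; have : 1 <= (k * K) * K by nra.
  by move: kK; move: (k * K) ((k * K) * K) => a b *; nra.
have ev' : 4 * (e * (k ^+ 2 * K ^+ 3)) <= v by move: ev; rewrite !mulrA.
have : e * (k * K) <= e * (k ^+ 2 * K ^+ 3) by rewrite ler_wpM2l.
have : e * 1 <= e * (k * K) by rewrite ler_wpM2l.
by split; nra.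
Qed.

(** Each of the first two terms is at most [v * e]. The third is at most 0.0235 times the second,
    because [e <= v / 4 <= 0.0235] and [1 <= K]. *)
Lemma perturbed_residual_le (v e k K : R) (x := 2 * k * K * e) :
  0 <= e -> 4 * e <= v -> 4 * (k * K * e) <= v ->
  4 * e * k ^+ 2 * K ^+ 3 <= v -> 0 <= K -> 1 <= K -> v <= 94 / 1000 ->
  2 * x * e + x ^+ 2 * K + x ^+ 2 * e <= (2 + 235 / 10000) * (v * e).
Proof.
move=> e0 ev4 kKev ev K0 K1 v94.
have xe : 2 * x * e <= v * e.
  by rewrite ler_wpM2r// (_ : 2 * x = 4 * (k * K * e))// /x; ring.
have xK : x ^+ 2 * K <= v * e.
  have -> : x ^+ 2 * K = (4 * e * k ^+ 2 * K ^+ 3) * e by rewrite /x; ring.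
  by rewrite ler_wpM2r.
have xxe : x ^+ 2 * e <= 235 / 10000 * (x ^+ 2 * K).
  rewrite mulrCA ler_wpM2l ?sqr_ge0//.
  by clear -ev4 K1 v94 e0; lra.
by move: xe xK xxe; clear; lra.
Qed.

(* 2.655 bounds (2 + 0.0235) * 1.2216 * 1.0722, the product of the growth
   factors of the residual, of k ^ 2 and of K ^ 3 when v <= 0.094. *)
Lemma weighted_contraction (v e k K : R) (x := 2 * k * K * e)
    (a := k * (4 * K * e + 2 * e ^+ 2)) :
  0 <= e -> 1 <= k -> 1 <= K -> 4 * e * k ^+ 2 * K ^+ 3 <= v ->
  v <= 94 / 1000 ->
  a <= 952 / 10000 /\
  4 * (2 * x * e + x ^+ 2 * K + x ^+ 2 * e) * (k / (1 - a)) ^+ 2 * (K + e) ^+ 3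
    <= 2655 / 1000 * v ^+ 2.
Proof.
move=> e0 k1 K1 ev v94.
have [ev4 kKev] := small_of_weighted e0 k1 K1 ev.
have k0 : 0 <= k := le_trans ler01 k1.
have K0 : 0 <= K := le_trans ler01 K1.
(* [a] is the relative loss allowed for the determinants. Both [e] and [k * e] are at most 0.0235,
   and 0.094 + 2 * 0.0235 ^ 2 < 0.0952. *)
have a_le : a <= 952 / 10000.
  have -> : a = 4 * (k * K * e) + 2 * (k * e) * e by rewrite /a; ring.
  have ke : k * e <= k * K * e by rewrite ler_wpM2r// ler_peMr.
  have ke0 : 0 <= k * e by rewrite mulr_ge0.
  by clear -e0 ev4 kKev v94 ke ke0; move: ke kKev; move: (k * K * e) => w *; nra.
split=> //.
have e'_le := perturbed_residual_le e0 ev4 kKev ev K0 K1 v94.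
rewrite -/x in e'_le.
(* Here [e <= 0.0235 * K], and 1.0235 ^ 3 < 1.0722. *)
have K'_le : (K + e) ^+ 3 <= 10722 / 10000 * K ^+ 3.
  have : (K + e) ^+ 3 <= (10235 / 10000 * K) ^+ 3.
    by apply: lerXn2r; rewrite ?nnegrE; clear -ev4 K1 v94 e0; lra.
  rewrite exprMn => /le_trans; apply; rewrite ler_wpM2r ?exprn_ge0//.
  by clear; lra.
(* The constant comes from 1 / (1 - 0.0952) ^ 2 < 1.2216. *)
have k'_le : (k / (1 - a)) ^+ 2 <= 12216 / 10000 * k ^+ 2.
  have a1 : 0 < 1 - a by clear -a_le; lra.
  rewrite expr_div_n ler_pdivrMr ?exprn_gt0// mulrAC ler_peMl ?sqr_ge0//.
  by clear -a_le; move: (a) a_le => b b_le; nra.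
have k'0 := sqr_ge0 (k / (1 - a)).
have K'0 : 0 <= (K + e) ^+ 3 by rewrite exprn_ge0// addr_ge0.
apply: (@le_trans _ _ (4 * ((2 + 235 / 10000) * (v * e))
  * (12216 / 10000 * k ^+ 2) * (10722 / 10000 * K ^+ 3))).
  have x0 : 0 <= x by rewrite /x !mulr_ge0.
  have e'0 : 0 <= 2 * x * e + x ^+ 2 * K + x ^+ 2 * e.
    by rewrite !addr_ge0 ?mulr_ge0 ?sqr_ge0.
  have le4 := ler_wpM2l (ler0n R 4) e'_le.
  have e'4 := mulr_ge0 (ler0n R 4) e'0.
  by apply: ler_pM => //; [rewrite mulr_ge0 | apply: ler_pM].
have v0 : 0 <= v by clear -e0 ev4; lra.
(* Regrouping exposes the weighted quantity again, which supplies the second factor [v]: this is the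
   quadratic gain. *)
have -> : 4 * ((2 + 235 / 10000) * (v * e)) * (12216 / 10000 * k ^+ 2)
    * (10722 / 10000 * K ^+ 3)
  = (2 + 235 / 10000) * (12216 / 10000) * (10722 / 10000)
    * (v * (4 * e * k ^+ 2 * K ^+ 3)) by field.
apply: le_trans (ler_wpM2l _ (ler_wpM2l v0 ev)) _; first by clear; lra.
by rewrite -expr2 ler_wpM2r ?sqr_ge0//; clear; lra.
Qed.

Lemma diag_part_diag Z : is_diag_mx (diag_part Z).
Proof. exact: diag_mx_is_diag. Qed.

Lemma diag_part_entry Z j : diag_part Z j j = Z j j.
Proof. by rewrite !mxE eqxx. Qed.

Lemma is_diag_mxD S S' : is_diag_mx S -> is_diag_mx S' -> is_diag_mx (S + S').
Proof.
move=> Sd S'd; apply/is_diag_mxP => j l jl.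
by rewrite mxE !is_diag_mx_offdiag// addr0.
Qed.

(** Expanding the perturbed determinant leaves two groups of three terms, each group bounded by
    [2 * K * e + e ^+ 2]. *)
Lemma sdet_perturb S1 S2 T1 T2 (e K : R) j l :
  (forall m, cmod (S1 m m) <= K) -> (forall m, cmod (S2 m m) <= K) ->
  (forall m, cmod (T1 m m) <= e) -> (forall m, cmod (T2 m m) <= e) ->
  cmod (sdet S1 S2 j l)
    <= cmod (sdet (S1 + T1) (S2 + T2) j l) + (4 * K * e + 2 * e ^+ 2).
Proof.
move=> S1K S2K T1e T2e.
have prod_le (x y : R[i]) (a b : R) :
    cmod x <= a -> cmod y <= b -> cmod (x * y) <= a * b.
  by move=> *; rewrite cmodM ler_pM ?cmod_ge0.
have term (A1 A2 B1 B2 : 'M[R[i]]_n) p q :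
    cmod (A1 p p) <= K -> cmod (A2 q q) <= K ->
    cmod (B1 p p) <= e -> cmod (B2 q q) <= e ->
    cmod (A1 p p * B2 q q + B1 p p * A2 q q + B1 p p * B2 q q)
      <= 2 * K * e + e ^+ 2.
  move=> A1K A2K B1e B2e.
  apply: le_trans (cmodD _ _) _.
  apply: le_trans (lerD (cmodD _ _) (lexx _)) _.
  have := prod_le _ _ _ _ A1K B2e; have := prod_le _ _ _ _ B1e A2K.
  by have := prod_le _ _ _ _ B1e B2e; lra.
have -> : sdet S1 S2 j l = sdet (S1 + T1) (S2 + T2) j l
  + (- (S1 j j * T2 l l + T1 j j * S2 l l + T1 j j * T2 l l)
     + (S1 l l * T2 j j + T1 l l * S2 j j + T1 l l * T2 j j)).
  by rewrite /sdet !mxE; ring.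
apply: le_trans (cmodD _ _) _; rewrite lerD2l.
apply: le_trans (cmodD _ _) _; rewrite cmodN.
have := term _ _ _ _ j l (S1K j) (S2K l) (T1e j) (T2e l).
by have := term _ _ _ _ l j (S1K l) (S2K j) (T1e l) (T2e j); lra.
Qed.

(** Since [Z + S] equals [F *m M *m E], the step is stated without [E], [F] and [M]. *)
Lemma newton_step S1 S2 Z1 Z2 Z1' Z2' v e k K
    (X := Xcorr S1 S2 Z1 Z2) (Y := Ycorr S1 S2 Z1 Z2) :
  newton_bounds S1 S2 Z1 Z2 v e k K -> v <= 94 / 1000 ->
  Z1' = (1%:M + Y) *m (Z1 + S1) *m (1%:M + X) - (S1 + diag_part Z1) ->
  Z2' = (1%:M + Y) *m (Z2 + S2) *m (1%:M + X) - (S2 + diag_part Z2) ->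
  exists e' k' K', newton_bounds (S1 + diag_part Z1) (S2 + diag_part Z2)
    Z1' Z2' (2655 / 1000 * v ^+ 2) e' k' K'.
Proof.
move=> nb v94 -> ->; have e0 := nb_e_ge0 nb.
have sd j l (jl : j != l) := nb_sdet_neq0 nb jl.
case: nb => d1 d2 k1 K1 ev sdk S1K S2K Z1e Z2e.
have k0 : 0 <= k by lra.
have K0 : 0 <= K by lra.
have [a_le contr] := weighted_contraction e0 k1 K1 ev v94.
have Xb := Xcorr_bound k0 K0 sdk S1K S2K Z1e Z2e.
have Yb := Ycorr_bound k0 K0 sdk S1K S2K Z1e Z2e.
have Z1d m : cmod (diag_part Z1 m m) <= e.
  by rewrite diag_part_entry (le_trans (entry_le_opnorm _ _ _) Z1e).
have Z2d m : cmod (diag_part Z2 m m) <= e.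
  by rewrite diag_part_entry (le_trans (entry_le_opnorm _ _ _) Z2e).
set a := k * (4 * K * e + 2 * e ^+ 2) in a_le contr.
have a0 : 0 <= a by rewrite /a mulr_ge0// addr_ge0 ?mulr_ge0 ?sqr_ge0.
have a1 : 0 < 1 - a by lra.
(* The first witness is the bound of [residual_bound] for corrections of norm at most
   [2 * k * K * e]; the last allows for diagonal entries moving by at most [e]. *)
exists (2 * (2 * k * K * e) * e + (2 * k * K * e) ^+ 2 * K
        + (2 * k * K * e) ^+ 2 * e), (k / (1 - a)), (K + e); split => //.
- exact: is_diag_mxD (diag_part_diag _).
- exact: is_diag_mxD (diag_part_diag _).
- by rewrite ler_pdivlMr// mul1r; lra.
- by lra.
(* With d and d' the old and new determinants, 1 <= k |d| <= k |d'| + a. *)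
- move=> j l jl; rewrite mulrAC ler_pdivlMr// mul1r.
  have := sdk _ _ jl.
  have := sdet_perturb j l S1K S2K Z1d Z2d.
  by move/(ler_wpM2l k0); rewrite mulrDr -/a; lra.
- by move=> j; rewrite mxE (le_trans (cmodD _ _))// lerD.
- by move=> j; rewrite mxE (le_trans (cmodD _ _))// lerD.
- exact: residual_bound (corr_linearized1 _ _ d1 sd) Xb Yb Z1e
    (opnorm_diag_le d1 K0 S1K).
- exact: residual_bound (corr_linearized2 _ _ d2 sd) Xb Yb Z2e
    (opnorm_diag_le d2 K0 S2K).
Qed.

(** The increments are bounded only relative to [P i], so the products are first bounded uniformly;
    [matrix_limit] then applies with constant [109 / 100 * u]. *)
Lemma product_limit (P : nat -> 'M[R[i]]_n) (u : R) :
  0 <= u -> u <= 94 / 1000 -> opnorm (P 0%N) <= 1 ->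
  (forall i, opnorm (P i.+1 - P i) <= opnorm (P i) * (r i * u)) ->
  exists L, forall i, opnorm (P i - L) <= 146 / 100 * r i * u.
Proof.
move=> u0 u94 P0 dP.
(* 1.09 satisfies 1.09 * 4 / 3 <= 1.46, and the term in [r i] pays for the
   growth at each step. *)
have Pb i : opnorm (P i) <= 109 / 100 - 18 / 100 * r i.
  elim: i => [|i IH]; first by rewrite quad_rate0; lra.
  have := opnormD (P i.+1 - P i) (P i); rewrite subrK => /le_trans; apply.
  apply: le_trans (lerD (dP i) (lexx _)) _.
  have r0 := quad_rate_gt0 R i; have rS := quad_rateS_le R i.
  have Pi0 := opnorm_ge0 (P i).
  have ru : r i * u <= 94 / 1000 * r i by nra.
  have : opnorm (P i) * (r i * u) <= 109 / 100 * (94 / 1000 * r i).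
    by apply: ler_pM => //; nra.
  by lra.
have [i|L PL] := @matrix_limit R n P (109 / 100 * u).
  apply: le_trans (dP i) _; rewrite -[leRHS]mulrA [u * r i]mulrC ler_wpM2r//.
    by rewrite mulr_ge0// ltW// quad_rate_gt0.
  by have := Pb i; have := quad_rate_gt0 R i; lra.
exists L => i; apply: le_trans (PL i) _.
have := quad_rate_gt0 R i => r0.
have : 0 <= r i * u by nra.
by lra.
Qed.

Lemma opnorm_rate_eq0 (A : 'M[R[i]]_n) c :
  (forall i, opnorm A <= c * r i) -> A = 0.
Proof.
move=> Ac.
have A0 : opnorm A <= 0.
  by apply: (@le_of_quad_rate _ _ _ c) => i; rewrite add0r.
apply/matrixP => j l; rewrite mxE; apply: ComplexField.Normc.eq0_normc.
by apply/eqP; rewrite eq_le cmod_ge0 (le_trans (entry_le_opnorm _ _ _) A0).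
Qed.

(** Expanding [F i *m M *m E i] around the limits writes the limiting residual, independent of [i],
    as a sum of errors of order [r i]; hence it is zero. *)
Lemma residual_limit (E F S Z : nat -> 'M[R[i]]_n) M
    (Einf Finf Sinf : 'M[R[i]]_n) (cE cF cS cZ : R) :
  (forall i, Z i = F i *m M *m E i - S i) ->
  (forall i, opnorm (E i - Einf) <= cE * r i) ->
  (forall i, opnorm (F i - Finf) <= cF * r i) ->
  (forall i, opnorm (S i - Sinf) <= cS * r i) ->
  (forall i, opnorm (Z i) <= cZ * r i) ->
  Finf *m M *m Einf - Sinf = 0.
Proof.
move=> ZE EL FL SL ZL.
pose m := opnorm M.
apply: (@opnorm_rate_eq0 _ (cZ + cS + (cF * m * opnorm Einf
  + opnorm Finf * m * cE + cF * m * cE))) => i.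
have -> : Finf *m M *m Einf - Sinf = (Z i + (S i - Sinf)) -
    ((F i - Finf) *m M *m Einf + Finf *m M *m (E i - Einf)
     + (F i - Finf) *m M *m (E i - Einf)).
  by rewrite ZE !mulmxBl !mulmxBr; apply/matrixP => j l; rewrite !mxE; ring.
have r0 := quad_rate_gt0 R i; have r1 := quad_rate_le R i.
have FM := opnormM_le (FL i) (lexx m).
have h1 := opnormM_le FM (lexx (opnorm Einf)).
have h2 := opnormM_le (opnormM Finf M) (EL i).
have h3 := opnormM_le FM (EL i).
have cF0 : 0 <= cF.
  by have := le_trans (opnorm_ge0 _) (FL i); rewrite pmulr_lge0.
have cE0 : 0 <= cE.
  by have := le_trans (opnorm_ge0 _) (EL i); rewrite pmulr_lge0.
(* The product of two errors is of order [r i ^+ 2], absorbed into [r i] because [r i <= 2^-1]. *)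
have h4 : cF * r i * m * (cE * r i) <= cF * m * cE * r i.
  have -> : cF * r i * m * (cE * r i) = cF * m * cE * r i * r i by ring.
  have : 0 <= cF * m * cE * r i by rewrite !mulr_ge0 ?opnorm_ge0// ltW.
  by nra.
apply: le_trans (opnormB _ _) _.
have g1 := le_trans (opnormD _ _) (lerD (ZL i) (SL i)).
have g2 := le_trans (opnormD _ _) (lerD h1 h2).
have g3 := le_trans (opnormD _ _) (lerD g2 (le_trans h3 h4)).
apply: le_trans (lerD g1 g3) _.
by rewrite -subr_ge0 (_ : _ - _ = 0) // /m; ring.
Qed.

Lemma is_diag_mx_limit (S : nat -> 'M[R[i]]_n) Sinf c :
  (forall i, is_diag_mx (S i)) ->
  (forall i, opnorm (S i - Sinf) <= c * r i) -> is_diag_mx Sinf.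
Proof.
move=> Sd SL; apply/is_diag_mxP => j l jl.
apply: ComplexField.Normc.eq0_normc; apply/eqP; rewrite eq_le cmod_ge0 andbT.
apply: (@le_of_quad_rate _ _ _ c) => i; rewrite add0r.
apply: le_trans (SL i); have := entry_le_opnorm (S i - Sinf) j l.
by rewrite !mxE (is_diag_mx_offdiag (Sd i) jl) sub0r cmodN.
Qed.

End Iteration.

(** * Quadratic convergence of the Newton sequences *)

Theorem theorem5 (R : realType) (n : nat) (M1 M2 : 'M[R[i]]_n)
    (E F S1 S2 Z1 Z2 X Y : nat -> 'M[R[i]]_n) (eps0 kappa0 K0 u : R)
    (hcomm : M1 *m M2 = M2 *m M1)
    (hM1 : distinct_eigenvalues M1) (hM2 : distinct_eigenvalues M2)
    (hE0 : E 0%N \in unitmx) (hF0 : F 0%N \in unitmx)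
    (hS1diag : is_diag_mx (S1 0%N)) (hS2diag : is_diag_mx (S2 0%N))
    (hS1inj : injective (fun j => S1 0%N j j))
    (hS2inj : injective (fun j => S2 0%N j j))
    (hdet : forall j l, j != l ->
      sdet (S1 0%N) (S2 0%N) j l != 0)
    (hZ1 : forall i, Z1 i = F i *m M1 *m E i - S1 i)
    (hZ2 : forall i, Z2 i = F i *m M2 *m E i - S2 i)
    (hX : forall i, X i = Xcorr (S1 i) (S2 i) (Z1 i) (Z2 i))
    (hY : forall i, Y i = Ycorr (S1 i) (S2 i) (Z1 i) (Z2 i))
    (hE : forall i, E i.+1 = E i *m (1%:M + X i))
    (hF : forall i, F i.+1 = (1%:M + Y i) *m F i)
    (hS1 : forall i, S1 i.+1 = S1 i + diag_part (Z1 i))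
    (hS2 : forall i, S2 i.+1 = S2 i + diag_part (Z2 i))
    (heps0 : eps0 = Num.max (opnorm (Z1 0%N)) (opnorm (Z2 0%N)))
    (hkappa0 : kappa0 = kappa (S1 0%N) (S2 0%N))
    (hK0 : K0 = Kmax (S1 0%N) (S2 0%N))
    (hu : u = 4 * eps0 * kappa0 ^+ 2 * K0 ^+ 3)
    (hu_le : u <= 94 / 1000) :
  (forall i j l, j != l -> sdet (S1 i) (S2 i) j l != 0) /\
  exists Einf Finf S1inf S2inf : 'M[R[i]]_n,
    [/\ is_diag_mx S1inf /\ is_diag_mx S2inf,
        Finf *m M1 *m Einf - S1inf = 0 /\ Finf *m M2 *m Einf - S2inf = 0,
        [/\ cvg_quadratically S1 S1inf, cvg_quadratically S2 S2inf,
            cvg_quadratically E Einf & cvg_quadratically F Finf],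
        [/\ E 0%N \in unitmx, F 0%N \in unitmx,
            Einf \in unitmx & Finf \in unitmx]
      & forall i,
          opnorm (E i - Einf)
            <= 146 / 100 * quad_rate R i * opnorm (E 0%N) * u /\
          opnorm (F i - Finf)
            <= 146 / 100 * quad_rate R i * opnorm (F 0%N) * u].
Proof.
set r := quad_rate R.
have u0 : 0 <= u.
  have k0 : 0 <= kappa0 by rewrite hkappa0 (le_trans ler01)// bigmax_ge_id.
  have K0_ge0 : 0 <= K0 by rewrite hK0 (le_trans ler01)// bigmax_ge_id.
  have e0 : 0 <= eps0 by rewrite heps0 le_max opnorm_ge0.
  by rewrite hu !mulr_ge0 ?exprn_ge0.
have residual0 M Z (S : nat -> 'M[R[i]]_n) :
    (forall i, Z i = F i *m M *m E i - S i) ->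
    (forall i, S i.+1 = S i + diag_part (Z i)) ->
    forall i, Z i.+1 = (1%:M + Y i) *m (Z i + S i) *m (1%:M + X i)
                       - (S i + diag_part (Z i)).
  by move=> ZE SE i; rewrite ZE SE hE hF {2}ZE subrK !mulmxA.
(* The factor 2 normalizes the start, since [2 * r 0 = 1]. *)
have nb i : exists e k K,
    newton_bounds (S1 i) (S2 i) (Z1 i) (Z2 i) (2 * r i * u) e k K.
  elim: i => [|i [e [k [K nb]]]].
    exists eps0, kappa0, K0; split => //.
    - by rewrite hkappa0; exact: bigmax_ge_id.
    - by rewrite hK0; exact: bigmax_ge_id.
    - by rewrite -hu /r quad_rate0 mulfV ?pnatr_eq0// mul1r.
    - move=> j l jl; rewrite -ler_pdivrMr.
      + rewrite mul1r hkappa0.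
        exact: (le_bigmax_cond _ (fun p => (cmod (sdet (S1 0) (S2 0) p.1 p.2))^-1)
          (j := (j, l))).
      + rewrite lt_def cmod_ge0 andbT; apply: contra (hdet _ _ jl).
        by move=> /eqP/ComplexField.Normc.eq0_normc ->.
    - move=> j; rewrite hK0; apply: le_trans (le_bigmax _ _ j).
      by rewrite le_max lexx.
    - move=> j; rewrite hK0; apply: le_trans (le_bigmax _ _ j).
      by rewrite le_max lexx orbT.
    - by rewrite heps0 le_max lexx.
    - by rewrite heps0 le_max lexx orbT.
  have r0 : 0 < r i := quad_rate_gt0 R i.
  have r1 : r i <= 2^-1 := quad_rate_le R i.
  have v94 : 2 * r i * u <= 94 / 1000 by clear -r0 r1 u0 hu_le; nra.
  have := residual0 _ _ _ hZ1 hS1 i; have := residual0 _ _ _ hZ2 hS2 i.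
  rewrite !hX !hY => Z2E Z1E.
  have [e' [k' [K' nb']]] := newton_step nb v94 Z1E Z2E.
  exists e', k', K'; rewrite hS1 hS2; case: nb' => *; split => //.
  apply: le_trans; first by eassumption.
  rewrite /r quad_rateS -/r.
  (* Here 10.62 = 4 * 2.655 and 10.62 * 0.094 < 1, while the target [2 * r i.+1 * u] equals
     [r i ^+ 2 * u]. *)
  rewrite (_ : _ * _ ^+ 2 = 1062 / 100 * u * (r i ^+ 2 * u)); last by field.
  rewrite (_ : 2 * _ * u = r i ^+ 2 * u); last by field.
  by apply: ler_piMl; [rewrite mulr_ge0 ?sqr_ge0 | clear -hu_le; lra].
(* No denominator of the corrections vanishes, so the iteration never relies on the default value of
   an inverse at zero. *)
split=> [i j l jl|].
  by have [e [k [K nbi]]] := nb i; exact: nb_sdet_neq0 nbi jl.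
(* With v = 2 r_i u, corrections are at most v / 2 and residuals at most v / 4. *)
have bnd i : [/\ opnorm (X i) <= r i * u, opnorm (Y i) <= r i * u,
    opnorm (Z1 i) <= u / 2 * r i & opnorm (Z2 i) <= u / 2 * r i].
  have [e [k [K nbi]]] := nb i; have e0 := nb_e_ge0 nbi.
  case: nbi => _ _ k1 K1 ev sdk S1K S2K Z1e Z2e.
  have [ev4 kKev] := small_of_weighted e0 k1 K1 ev.
  have k0 := le_trans ler01 k1; have K0' := le_trans ler01 K1.
  have e_le : e <= u / 2 * r i by clear -ev4; lra.
  have x_le : 2 * k * K * e <= r i * u by clear -kKev; rewrite -!mulrA; lra.
  split; [| |exact: le_trans Z1e e_le|exact: le_trans Z2e e_le].
  - by rewrite hX (le_trans _ x_le)// Xcorr_bound.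
  - by rewrite hY (le_trans _ x_le)// Ycorr_bound.
(* Factoring out [E 0] gives a sequence starting at the identity, so the final bound involves the
   norm of [E 0] but not that of its inverse. *)
have [P PL] : exists P, forall i,
    opnorm (invmx (E 0) *m E i - P) <= 146 / 100 * r i * u.
  apply: product_limit => // [|i]; first by rewrite mulVmx// opnorm1.
  rewrite hE mulmxDr mulmx1 mulmxDr addrC addKr mulmxA.
  by apply: opnormM_le => //; have [] := bnd i.
have [Q QL] : exists Q, forall i,
    opnorm (F i *m invmx (F 0) - Q) <= 146 / 100 * r i * u.
  apply: product_limit => // [|i]; first by rewrite mulmxV// opnorm1.
  rewrite hF mulmxDl mul1mx mulmxDl addrC addKr -mulmxA mulrC.
  by apply: opnormM_le => //; have [] := bnd i.
have [S1inf S1L] : exists L, forall i,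
    opnorm (S1 i - L) <= 4 / 3 * (u / 2) * r i.
  apply: matrix_limit => i; rewrite hS1 addrC addKr.
  by apply: le_trans (opnorm_diag_part _) _; have [] := bnd i.
have [S2inf S2L] : exists L, forall i,
    opnorm (S2 i - L) <= 4 / 3 * (u / 2) * r i.
  apply: matrix_limit => i; rewrite hS2 addrC addKr.
  by apply: le_trans (opnorm_diag_part _) _; have [] := bnd i.
(* At index 0 the distance is at most 1.46 * 0.5 * 0.094 < 1. *)
have near1_unit A : opnorm (1%:M - A) <= 146 / 100 * r 0 * u -> A \in unitmx.
  move=> A1; rewrite -[A](addrNK 1%:M) addrC unitmx_opnorm_lt1//.
  rewrite -opnormN opprB (le_lt_trans A1)// /r quad_rate0.
  by clear -hu_le; lra.
have EL i : opnorm (E i - E 0 *m P) <= 146 / 100 * r i * opnorm (E 0) * u.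
  rewrite -[E i](mulKVmx hE0) -mulmxBr mulrAC mulrC.
  exact: opnormM_le.
have FL i : opnorm (F i - Q *m F 0) <= 146 / 100 * r i * opnorm (F 0) * u.
  rewrite -[F i](mulmxKV hF0) -mulmxBl mulrAC.
  exact: opnormM_le.
have EL' i : opnorm (E i - E 0 *m P) <= 146 / 100 * opnorm (E 0) * u * r i.
  by have := EL i; congr (_ <= _); ring.
have FL' i : opnorm (F i - Q *m F 0) <= 146 / 100 * opnorm (F 0) * u * r i.
  by have := FL i; congr (_ <= _); ring.
have Z1L i : opnorm (Z1 i) <= u / 2 * r i by have [] := bnd i.
have Z2L i : opnorm (Z2 i) <= u / 2 * r i by have [] := bnd i.
exists (E 0 *m P), (Q *m F 0), S1inf, S2inf; split.
- split.
  + apply: is_diag_mx_limit S1L => i.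
    by have [e [k [K nbi]]] := nb i; exact: nb_diag1 nbi.
  + apply: is_diag_mx_limit S2L => i.
    by have [e [k [K nbi]]] := nb i; exact: nb_diag2 nbi.
- by split; [exact: residual_limit hZ1 EL' FL' S1L Z1L
            |exact: residual_limit hZ2 EL' FL' S2L Z2L].
- by split; [exists (4 / 3 * (u / 2)) | exists (4 / 3 * (u / 2))
    | exists (146 / 100 * opnorm (E 0) * u)
    | exists (146 / 100 * opnorm (F 0) * u)].
- split=> //; rewrite unitmx_mul ?hE0 ?hF0 ?andbT/=.
  + by apply: near1_unit; have := PL 0; rewrite mulVmx.
  + by apply: near1_unit; have := QL 0; rewrite mulmxV.
- by [].
Qed.
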